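(* Let $G$ be a finitely generated group. 1. If $G$ is amenable and torsion, then either no harmonic cocycle of a unitary representation of $G$ is proper, or $G$ has a finite FC-centre. 2. Let $\mu$ be a symmetric probability measure whose support is a finite generating set of $G$. If $G$ is $\mu$-Liouville and the abelianisation of $G$ is torsion, then either no $\mu$-harmonic cocycle of a unitary representation of $G$ is proper, or $G$ has a finite centre.
   Context: The FC-centre of $G$ is the subgroup of elements with finite conjugacy class. A group is torsion if all its elements have finite order. A cocycle of a unitary representation $\pi$ of $G$ on $\mathsf{H}$ is a map $b:G\to\mathsf{H}$ with $b(gh)=b(g)+\pi(g)b(h)$. It is $\mu$-harmonic if $\sum_{s}\mu(s)b(s)=0$; it is called harmonic if it is $\mu$-harmonic for some symmetric ($\mu(s)=\mu(s^{-1})$) probability measure $\mu$ whose support is a finite generating set of $G$. The cocycle is proper if $\{g\in G:\|b(g)\|\le R\}$ is finite for every $R\ge 0$. $G$ is $\mu$-Liouville if every bounded $f:G\to\mathbb{C}$ with $\sum_s\mu(s)f(s^{-1}x)=f(x)$ for all $x\in G$ is constant. *)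

(* Defs.v *)
From HB Require Import structures.
From mathcomp Require Import all_boot all_order all_algebra generic_quotient.
From mathcomp Require Import sesquilinear.
From mathcomp Require Import complex.
From mathcomp Require Import all_classical all_reals topology normedtype.

Set Implicit Arguments.
Unset Strict Implicit.
Unset Printing Implicit Defensive.

Import Order.TTheory GRing.Theory Num.Theory.
Import numFieldNormedType.Exports.

Local Open Scope classical_set_scope.
Local Open Scope ring_scope.
Local Open Scope complex_scope.

Section Groups.
Variable G : groupType.
Local Open Scope group_scope.
Implicit Types (x y : G) (S : set G).

Definition subgroup S : Prop := group_closed (mem S).

Definition gen S : set G := smallest subgroup S.

Definition generates S : Prop := gen S = setT.

Definition finitely_generated : Prop :=
  exists S : set G, finite_set S /\ generates S.

Definition torsion : Prop :=
  forall x, exists n : nat, (0 < n)%N /\ x ^+ n = 1.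

Definition centre : set G := [set x | forall y, commute x y].

Definition FC_centre : set G := [set x | finite_set (range (fun y => x ^ y))].

Definition derived_subgroup : set G :=
  gen [set z | exists x y, z = [~ x, y]].

End Groups.
Arguments finitely_generated : clear implicits.
Arguments torsion : clear implicits.
Arguments centre : clear implicits.
Arguments FC_centre : clear implicits.
Arguments derived_subgroup : clear implicits.

Section Abelianisation.
Variable G : groupType.
Local Open Scope group_scope.
Local Open Scope quotient_scope.
Implicit Types x y z : G.

Let D : set G := derived_subgroup G.

Lemma derived1 : D 1.
Proof. by move=> A [[A1 _] _]; rewrite -in_setE. Qed.

Lemma derived_div x y : D x -> D y -> D (x / y).
Proof.
move=> Dx Dy A /[dup] AP [[_ AB] _]; rewrite -in_setE.
by apply: AB; rewrite inE; [exact: Dx | exact: Dy].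
Qed.

Lemma derivedV x : D x -> D x^-1.
Proof. by move=> Dx; rewrite -div1g; apply: derived_div => //; exact: derived1. Qed.

Lemma derivedM x y : D x -> D y -> D (x * y).
Proof. by move=> Dx /derivedV Dy; rewrite -[y]invgK; exact: derived_div. Qed.

Lemma derived_comm x y : D [~ x, y].
Proof. by apply: sub_gen_smallest; exists x, y. Qed.

Lemma derivedJ x y : D x -> D (x ^ y).
Proof.
move=> Dx; have -> : x ^ y = x * [~ x, y] by rewrite /commg mulVKg.
by apply: derivedM => //; exact: derived_comm.
Qed.

Definition ab_rel x y : bool := `[< D (x^-1 * y) >].

Fact ab_rel_refl : reflexive ab_rel.
Proof. by move=> x; apply/asboolP; rewrite mulVg; exact: derived1. Qed.

Fact ab_rel_sym : symmetric ab_rel.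
Proof.
by move=> x y; apply/asboolP/asboolP => /derivedV; rewrite invgM invgK.
Qed.

Fact ab_rel_trans : transitive ab_rel.
Proof.
move=> y x z /asboolP xy /asboolP yz; apply/asboolP.
by have := derivedM xy yz; rewrite mulgA mulgK.
Qed.

Canonical ab_equiv := EquivRel ab_rel ab_rel_refl ab_rel_sym ab_rel_trans.

Definition abelianisation := {eq_quot ab_rel}.
HB.instance Definition _ := Choice.on abelianisation.
HB.instance Definition _ := EqQuotient.on abelianisation.

Let Q := abelianisation.

Definition ab_one : Q := \pi_Q 1.
Definition ab_inv : Q -> Q := fun a => \pi_Q (repr a)^-1.
Definition ab_mul : Q -> Q -> Q := fun a b => \pi_Q (repr a * repr b).

Lemma ab_eqP x y : \pi_Q x = \pi_Q y <-> D (x^-1 * y).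
Proof. by split=> [/eqmodP/asboolP|?] //; apply/eqmodP/asboolP. Qed.

Lemma ab_pi_inv x : ab_inv (\pi_Q x) = \pi_Q x^-1.
Proof.
apply/ab_eqP; rewrite invgK; set r := repr _.
have /ab_eqP/(derivedJ x^-1) : \pi_Q x = \pi_Q r by rewrite /r reprK.
by rewrite /conjg invgK !mulgA mulgV mul1g.
Qed.

Lemma ab_pi_mul x y : ab_mul (\pi_Q x) (\pi_Q y) = \pi_Q (x * y).
Proof.
apply/ab_eqP; set r := repr (\pi_Q x); set s := repr (\pi_Q y).
have /ab_eqP rx : \pi_Q r = \pi_Q x by rewrite /r reprK.
have /ab_eqP sy : \pi_Q s = \pi_Q y by rewrite /s reprK.
have := derivedM (derivedJ s rx) sy.
by rewrite /conjg invgM !mulgA mulgK.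
Qed.

Fact ab_mulA : associative ab_mul.
Proof.
move=> a b c; rewrite -[a]reprK -[b]reprK -[c]reprK.
move: (repr a) (repr b) (repr c) => x y z.
by rewrite (ab_pi_mul y z) (ab_pi_mul x y) (ab_pi_mul x) ab_pi_mul mulgA.
Qed.

Fact ab_mul1 : left_id ab_one ab_mul.
Proof. by move=> a; rewrite -[a]reprK ab_pi_mul mul1g. Qed.

Fact ab_mulg1 : right_id ab_one ab_mul.
Proof. by move=> a; rewrite -[a]reprK ab_pi_mul mulg1. Qed.

Fact ab_mulV : left_inverse ab_one ab_inv ab_mul.
Proof. by move=> a; rewrite -[a]reprK ab_pi_inv ab_pi_mul mulVg. Qed.

Fact ab_mulgV : right_inverse ab_one ab_inv ab_mul.
Proof. by move=> a; rewrite -[a]reprK ab_pi_inv ab_pi_mul mulgV. Qed.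

HB.instance Definition _ :=
  isGroup.Build abelianisation ab_mulA ab_mul1 ab_mulg1 ab_mulV ab_mulgV.

End Abelianisation.

(* [hdot] is linear in its first argument and conjugate-linear in the
   second. *)
HB.mixin Record isHilbert (R : realType) H of CompleteNormedModule R[i] H := {
  hdot : {dot H for Num.conj};
  hdot_norm : forall u : H, `|u| ^+ 2 = hdot u u
}.

#[short(type="hilbertType")]
HB.structure Definition Hilbert (R : realType) :=
  {H of isHilbert R H & CompleteNormedModule R[i] H}.

Definition unitary (R : realType) (H : hilbertType R) (u : {linear H -> H}) :=
  bijective u /\ forall x y : H, hdot (u x) (u y) = hdot x y.

Record unitary_rep (R : realType) (G : groupType) (H : hilbertType R) :=
  UnitaryRep {
    urep :> G -> {linear H -> H};
    urep_unitary : forall g, unitary (urep g);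
    urep1 : forall x, urep 1%g x = x;
    urepM : forall g h x, urep (g * h)%g x = urep g (urep h x)
  }.

Section Cocycles.
Variables (R : realType) (G : groupType).

Definition msupport (mu : G -> R) : set G := [set s | mu s != 0].

Record sym_gen_prob (mu : G -> R) : Prop := SymGenProb {
  mu_ge0 : forall s, 0 <= mu s;
  mu_finite : finite_set (msupport mu);
  mu_sum1 : \sum_(s \in msupport mu) mu s = 1;
  mu_sym : forall s, mu s^-1%g = mu s;
  mu_gen : generates (msupport mu)
}.

Definition liouville (mu : G -> R) : Prop :=
  forall f : G -> R[i], bounded_fun (f : G -> R[i]^o) ->
    (forall x, \sum_(s \in msupport mu) (mu s)%:C * f (s^-1 * x)%g = f x) ->
    exists c, f = cst c.

Variable H : hilbertType R.

Definition cocycle (pi : unitary_rep G H) (b : G -> H) : Prop :=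
  forall g h, b (g * h)%g = b g + pi g (b h).

Definition mu_harmonic (mu : G -> R) (b : G -> H) : Prop :=
  \sum_(s \in msupport mu) (mu s)%:C *: b s = 0.

Definition harmonic (b : G -> H) : Prop :=
  exists mu, sym_gen_prob mu /\ mu_harmonic mu b.

Definition proper_cocycle (b : G -> H) : Prop :=
  forall r : R, 0 <= r -> finite_set [set g | `|b g| <= r%:C].

End Cocycles.

Section Amenability.
Variables (R : realType) (G : groupType).

(* The values of [m] on unbounded functions are irrelevant. *)
Record invariant_mean (m : (G -> R) -> R) : Prop := InvariantMean {
  mean_linear : forall (a : R) (f g : G -> R), bounded_fun f -> bounded_fun g ->
    m (fun x => a * f x + g x) = a * m f + m g;
  mean_ge0 : forall f : G -> R,
    bounded_fun f -> (forall x, 0 <= f x) -> 0 <= m f;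
  mean1 : m (fun=> 1) = 1;
  mean_invariant : forall (g : G) (f : G -> R), bounded_fun f ->
    m (fun x => f (g^-1 * x)%g) = m f
}.

Definition amenable : Prop := exists m, invariant_mean m.

End Amenability.

(* Main.v *)
(** Let [z] have a finite conjugacy class [C] and let [w] be the sum of the
    [b c], [c] in [C]. Expanding [b (c g) = b (g c^g)] and summing over [C] gives
    [\sum_(c in C) (b g - pi c (b g)) = w - pi g w], so harmonicity of [b] makes
    [w] its own [mu]-average under [pi]. By strict convexity [w] is invariant,
    and then, averaging over [C] this time, [pi z] fixes every [b g]. Hence
    [b (z^n) = n b z], so torsion elements of the FC-centre lie in the kernel
    of [b]. If [z] is central then [w = b z] is invariant, so [g |-> <b g, b z>]
    is a homomorphism to the additive group of the complex numbers; it vanishes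
    when the abelianisation is torsion, whence [b z = 0]. Finally the kernel of
    a proper cocycle is finite. *)

Require Import Defs.
From mathcomp Require Import all_boot all_order all_algebra.
From mathcomp Require Import complex finmap.
From mathcomp Require Import all_classical all_reals.

Set Implicit Arguments.
Unset Strict Implicit.
Unset Printing Implicit Defensive.

Import Order.TTheory GRing.Theory Num.Theory.

Local Open Scope classical_set_scope.
Local Open Scope ring_scope.
Local Open Scope complex_scope.

Lemma gen_sub_subgroup (G : groupType) (A S : set G) :
  subgroup S -> A `<=` S -> gen A `<=` S.
Proof. exact: smallest_sub. Qed.

Lemma pi_abelianisationX (G : groupType) (x : G) n :
  (\pi_(abelianisation G)%qT x ^+ n)%g = \pi_(abelianisation G)%qT (x ^+ n)%g.
Proof.
elim: n => [|n IHn]; first by [].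
by rewrite !expgS IHn; exact: ab_pi_mul.
Qed.

(** Used to reindex sums over a conjugacy class. *)
Lemma conj_class_bij (G : groupType) (x g : G) :
  let C := range (fun y => x ^ y)%g in set_bij C C (fun c => c ^ g)%g.
Proof.
split=> [_ [y _ <-]|c d _ _ /conjg_inj //|_ [y _ <-]].
  by exists (y * g)%g => //; rewrite conjgM.
exists (x ^ (y / g))%g; first by exists (y / g)%g.
by rewrite -conjgM mulgVK.
Qed.

Section UnitaryRep.
Variables (R : realType) (G : groupType) (H : hilbertType R).
Variable pi : unitary_rep G H.

Lemma hdot_eq0 (u : H) : hdot u u = 0 -> u = 0.
Proof.
by move=> u0; apply/eqP; rewrite -normr_eq0 -sqrf_eq0 hdot_norm u0.
Qed.

Lemma hdot0l (x : H) : hdot 0 x = 0.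
Proof. exact: linear0l. Qed.

Lemma hdotDl (u v x : H) : hdot (u + v) x = hdot u x + hdot v x.
Proof. exact: linearDl. Qed.

Lemma hdotBl (u v x : H) : hdot (u - v) x = hdot u x - hdot v x.
Proof. exact: linearBl. Qed.

Lemma hdotBr (u v x : H) : hdot x (u - v) = hdot x u - hdot x v.
Proof. exact: linearBr. Qed.

Lemma hdotC (u v : H) : hdot u v = Num.conj (hdot v u).
Proof. by rewrite (hermC hdot) expr0 mul1r. Qed.

Lemma urep_hdot g u v : hdot (pi g u) (pi g v) = hdot u v.
Proof. by have [] := urep_unitary pi g. Qed.

(** Unitarity turns [hdot (pi g w) (pi g w)] into [hdot w w], so the pairing with [- pi g w] is the
    conjugate of the pairing with [w]. *)
Lemma hdot_sub_urep g (w : H) :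
  hdot (w - pi g w) (w - pi g w) =
  hdot (w - pi g w) w + Num.conj (hdot (w - pi g w) w).
Proof.
by rewrite -hdotC !hdotBr [hdot _ (pi g w)]hdotBl urep_hdot opprB.
Qed.

(* Pairing the equation with [w] and adding the conjugate turns it into
   [\sum_x p x * `|w - pi x w|^2 = 0]. *)
Lemma averaging_fixed (s : seq G) (p : G -> R) (w : H) :
    (forall x, 0 <= p x) ->
    \sum_(x <- s) (p x)%:C *: (w - pi x w) = 0 ->
  forall x, x \in s -> p x != 0 -> pi x w = w.
Proof.
move=> p0 sum0 x xs px.
pose F y := (p y)%:C * hdot (w - pi y w) (w - pi y w).
have dot0 : \sum_(y <- s) (p y)%:C * hdot (w - pi y w) w = 0.
  transitivity (hdot (\sum_(y <- s) (p y)%:C *: (w - pi y w)) w).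
    by rewrite linear_sumlz; apply: eq_bigr => y _; rewrite linearZl_LR.
  by rewrite sum0 hdot0l.
have F0 y : 0 <= F y.
  by rewrite mulr_ge0 ?ler0c// -hdot_norm exprn_ge0.
have conjM (a : R) (c : R[i]) : Num.conj (a%:C * c) = a%:C * Num.conj c.
  by rewrite rmorphM; congr (_ * _); exact: conjc_real.
have sumF : \sum_(y <- s) F y = 0.
  under eq_bigr do rewrite /F hdot_sub_urep mulrDr.
  rewrite big_split /= dot0 add0r.
  have := congr1 Num.conj dot0; rewrite conjC0 rmorph_sum; apply: etrans.
  by apply: eq_bigr => y _; exact/esym/conjM.
have /eqP := sumF; rewrite psumr_eq0 // => /allP/(_ x xs)/=.
rewrite mulf_eq0 => /orP[|/eqP/hdot_eq0/subr0_eq //].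
by move/eqP => [/eqP]; rewrite (negPf px).
Qed.

(** Reduces invariance of a vector to invariance under generators. *)
Lemma stabiliser_subgroup (w : H) : subgroup [set g | pi g w = w].
Proof.
split=> [|x y]; rewrite !inE /=; first by rewrite urep1.
by move=> xw yw; rewrite urepM -[in LHS]yw -(urepM pi y^-1) mulVg urep1.
Qed.

Variable b : G -> H.
Hypothesis bP : cocycle pi b.

Lemma cocycle1 : b 1%g = 0.
Proof.
by have := bP 1%g 1%g; rewrite mulg1 urep1 => /eqP; rewrite -subr_eq subrr => /eqP.
Qed.

Lemma cocycleX z n : pi z (b z) = b z -> b (z ^+ n)%g = b z *+ n.
Proof.
move=> zb; elim: n => [|n IHn]; first by rewrite cocycle1.
by rewrite expgS bP IHn raddfMn /= zb mulrS.
Qed.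

Section InvariantVector.
Variable v : H.
Hypothesis piv : forall g, pi g v = v.

(** Since [v = pi x v], unitarity makes [pi x (b y)] pair with [v] just as [b y] does. *)
Lemma hdot_cocycleM x y : hdot (b (x * y)%g) v = hdot (b x) v + hdot (b y) v.
Proof. by rewrite bP hdotDl -[in hdot (pi x _) v](piv x) urep_hdot. Qed.

Lemma hdot_cocycleV x : hdot (b x^-1%g) v = - hdot (b x) v.
Proof. by apply/eqP; rewrite -addr_eq0 -hdot_cocycleM mulVg cocycle1 hdot0l. Qed.

Lemma hdot_cocycleX x n : hdot (b (x ^+ n)%g) v = hdot (b x) v *+ n.
Proof.
elim: n => [|n IHn]; first by rewrite cocycle1 hdot0l.
by rewrite expgS hdot_cocycleM IHn mulrS.
Qed.

Lemma hdot_cocycle_subgroup : subgroup [set g | hdot (b g) v = 0].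
Proof.
split=> [|x y]; rewrite !inE /=; first by rewrite cocycle1 hdot0l.
by move=> bx by_; rewrite hdot_cocycleM hdot_cocycleV bx by_ subrr.
Qed.

(** A positive power of [g] lies in the derived subgroup, which is killed by every homomorphism to
    the additive group of the complex numbers; that group is torsion-free. *)
Lemma hdot_cocycle_invariant g : torsion (abelianisation G) ->
  hdot (b g) v = 0.
Proof.
move=> tor; have [n [n0]] := tor (\pi_(abelianisation G)%qT g).
rewrite pi_abelianisationX => /esym/ab_eqP; rewrite invg1 mul1g.
move=> /(gen_sub_subgroup hdot_cocycle_subgroup) /=; rewrite hdot_cocycleX.
move=> /(_ _)/eqP; rewrite mulrn_eq0 eqn0Ngt n0 => /(_ _)/eqP.
(* It remains to kill the commutators, which generate the derived subgroup. *)
apply=> _ [x [y ->]] /=.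
rewrite /commg /conjg !hdot_cocycleM !hdot_cocycleV.
by rewrite addrA -opprD addNr.
Qed.

End InvariantVector.

Section FCElement.
Variables (mu : G -> R) (z : G).
Hypotheses (muP : sym_gen_prob mu) (b_harm : mu_harmonic mu b).
Hypothesis zFC : FC_centre G z.

Let C : set G := range (fun y => z ^ y)%g.
Let w : H := \sum_(c \in C) b c.

Lemma class_sum_coboundary g :
  \sum_(c \in C) (b g - pi c (b g)) = w - pi g w.
Proof.
(* Conjugation by [g] permutes [C]. *)
have -> : pi g w = \sum_(c \in C) pi g (b (c ^ g)%g).
  rewrite /w (reindex_fsbig (fun c => c ^ g)%g C C); last exact: conj_class_bij.
  by rewrite !fsbig_finite // raddf_sum.
rewrite /w !fsbig_finite // -sumrB; apply: eq_bigr => c _.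
(* Both sides are [b (c * g)], because [c * g = g * c ^ g]. *)
have e : b c + pi c (b g) = b g + pi g (b (c ^ g)%g).
  by rewrite -!bP /conjg !mulgA mulgV mul1g.
by apply/eqP; rewrite subr_eq addrAC eq_sym subr_eq e.
Qed.

Lemma class_sum_invariant g : pi g w = w.
Proof.
have [mu0 muf _ _ mugen] := muP.
suff : gen (msupport mu) `<=` [set g | pi g w = w] by apply; rewrite mugen.
apply: gen_sub_subgroup => [|s mus /=]; first exact: stabiliser_subgroup.
apply: (averaging_fixed (s := fset_set (msupport mu)) mu0) => //; last first.
  by rewrite in_fset_set// inE.
under eq_bigr do rewrite -class_sum_coboundary fsbig_finite// scaler_sumr.
(* After the exchange, the term at [c] is [B - pi c B] with [B] the [mu]-average of [b], which
   vanishes by harmonicity. *)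
rewrite exchange_big big1 //= => c _.
pose B := \sum_(x <- fset_set (msupport mu)) (mu x)%:C *: b x.
have B0 : B = 0 by rewrite /B -fsbig_finite.
transitivity (B - pi c B); last by rewrite B0 raddf0 subr0.
rewrite /B raddf_sum -sumrB; apply: eq_bigr => x _.
by rewrite scalerBr; congr (_ - _); exact/esym/linearZ.
Qed.

Lemma FC_fixes_cocycle g : pi z (b g) = b g.
Proof.
(* Now the average runs over [C] with all weights 1, and the averaged vector is [b g]. *)
apply: (averaging_fixed (s := fset_set C) (p := cst 1)) => //.
- under eq_bigr do rewrite scale1r.
  by rewrite -fsbig_finite// class_sum_coboundary class_sum_invariant subrr.
- by rewrite in_fset_set// inE; exists 1%g => //; rewrite conjg1.
- exact: oner_neq0.
Qed.

Lemma FC_torsion_cocycle0 n : (0 < n)%N -> (z ^+ n = 1)%g -> b z = 0.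
Proof.
move=> n0 zn; have := cocycleX n (FC_fixes_cocycle z).
rewrite zn cocycle1 -scaler_nat => /esym/eqP.
by rewrite scaler_eq0 pnatr_eq0 eqn0Ngt n0 => /eqP.
Qed.

Lemma central_class_sum : centre G z -> w = b z.
Proof.
move=> zc; rewrite /w; have -> : C = [set z]; last by rewrite fsbig_set1.
have zJ y : (z ^ y = z)%g by rewrite /conjg (zc y) mulKg.
by apply/seteqP; split=> [_ [y _ <-]|_ ->]; [exact: zJ | exists 1%g].
Qed.

End FCElement.

Lemma centre_FC : centre G `<=` FC_centre G.
Proof.
move=> z zc; apply: (@sub_finite_set _ _ [set z]); last exact: finite_set1.
by move=> _ [y _ <-] /=; rewrite /conjg (zc y) mulKg.
Qed.

Lemma proper_kernel_finite (A : set G) : proper_cocycle b ->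
  (forall z, A z -> b z = 0) -> finite_set A.
Proof.
(* The kernel of [b] is its sublevel set of radius 0. *)
move=> b_proper b0; apply: sub_finite_set (b_proper 0 _) => // z Az /=.
by rewrite b0 // normr0.
Qed.

End UnitaryRep.

Theorem corollary4p15 (R : realType) (G : groupType)
    (Gfg : finitely_generated G) :
  (amenable R G -> torsion G ->
     (forall (H : hilbertType R) (pi : unitary_rep G H) (b : G -> H),
        cocycle pi b -> harmonic b -> ~ proper_cocycle b)
     \/ finite_set (FC_centre G))
  /\
  (forall mu : G -> R, sym_gen_prob mu ->
     liouville mu -> torsion (abelianisation G) ->
     (forall (H : hilbertType R) (pi : unitary_rep G H) (b : G -> H),
        cocycle pi b -> mu_harmonic mu b -> ~ proper_cocycle b)
     \/ finite_set (centre G)).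
Proof.
split=> [_ tor|mu muP _ tor].
- have [?|ninf] := pselect (finite_set (FC_centre G)); [by right | left].
  move=> H pi b bP [mu [muP b_harm]] /proper_kernel_finite b0.
  apply: ninf; apply: b0 => z zFC; have [n [n0 zn]] := tor z.
  exact: (FC_torsion_cocycle0 bP muP b_harm zFC n0 zn).
- have [?|ninf] := pselect (finite_set (centre G)); [by right | left].
  move=> H pi b bP b_harm /proper_kernel_finite b0.
  (* The invariant vector is [b z] itself, and the homomorphism it defines is evaluated at [z]. *)
  apply: ninf; apply: b0 => z zc; apply: hdot_eq0.
  apply: (hdot_cocycle_invariant bP) => // g.
  have zFC := centre_FC zc.
  rewrite -(central_class_sum b zc).
  exact: (class_sum_invariant bP muP b_harm zFC).
Qed.
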